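(* For every prime number $k$, the initial algebra $\mathit{Md}_k$ of the equational theory of meadows together with the equation $\underline{k}=0$ is isomorphic (as a $\Sigma$-algebra) to the zero totalized prime field of characteristic $k$, i.e. $\mathbb{Z}/k\mathbb{Z}$ with $x^{-1}$ the field inverse for $x\ne 0$ and $0^{-1}=0$.
   Context: $\Sigma$ is the signature with constants $0,1$, binary operations $+,\cdot$, and unary operations $-$ and ${}^{-1}$, all total. A meadow is a $\Sigma$-algebra that is a commutative ring with unit (possibly trivial) and satisfies $(x^{-1})^{-1}=x$ and $x\cdot(x\cdot x^{-1})=x$ for all $x$; $\mathit{Md}$ denotes the corresponding set of equations. Numerals are defined by $\underline{0}=0$, $\underline{n+1}=\underline{n}+1$. For a positive natural number $k$, $\mathit{Md}_k$ is the initial algebra of $\mathit{Md}\cup\{\underline{k}=0\}$: the (unique up to isomorphism) meadow satisfying $\underline{k}=0$ that has exactly one $\Sigma$-homomorphism to every meadow satisfying $\underline{k}=0$; equivalently, closed $\Sigma$-terms modulo provable equality from $\mathit{Md}\cup\{\underline{k}=0\}$. *)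

(* Defs.v *)
From HB Require Import structures.
From mathcomp Require Import all_boot all_algebra.
From mathcomp Require Import boolp.

Set Implicit Arguments.
Unset Strict Implicit.
Unset Printing Implicit Defensive.

Record sigma_algebra := SigmaAlgebra {
  carrier :> Type;
  op0 : carrier;
  op1 : carrier;
  op_add : carrier -> carrier -> carrier;
  op_mul : carrier -> carrier -> carrier;
  op_opp : carrier -> carrier;
  op_inv : carrier -> carrier
}.
Arguments op0 {s}.
Arguments op1 {s}.

Record sigma_hom (A B : sigma_algebra) (f : A -> B) : Prop := SigmaHom {
  hom0 : f op0 = op0;
  hom1 : f op1 = op1;
  hom_add : forall x y, f (op_add x y) = op_add (f x) (f y);
  hom_mul : forall x y, f (op_mul x y) = op_mul (f x) (f y);
  hom_opp : forall x, f (op_opp x) = op_opp (f x);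
  hom_inv : forall x, f (op_inv x) = op_inv (f x)
}.

Definition sigma_isomorphic (A B : sigma_algebra) : Prop :=
  exists f : A -> B, sigma_hom f /\ bijective f.

Inductive term (V : Type) : Type :=
| Var of V
| Zero
| One
| Add of term V & term V
| Mul of term V & term V
| Opp of term V
| Inv of term V.
Arguments Zero {V}.
Arguments One {V}.

Declare Scope sigma_scope.
Delimit Scope sigma_scope with Sg.
Bind Scope sigma_scope with term.
Notation "0" := Zero : sigma_scope.
Notation "1" := One : sigma_scope.
Notation "s + t" := (Add s t) : sigma_scope.
Notation "s * t" := (Mul s t) : sigma_scope.
Notation "- t" := (Opp t) : sigma_scope.
Notation "t ^-1" := (Inv t) : sigma_scope.

Fixpoint subst (V W : Type) (sg : V -> term W) (t : term V) : term W :=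
  match t with
  | Var v => sg v
  | Zero => 0
  | One => 1
  | Add s t => subst sg s + subst sg t
  | Mul s t => subst sg s * subst sg t
  | Opp t => - subst sg t
  | Inv t => (subst sg t)^-1
  end%Sg.

Fixpoint eval (A : sigma_algebra) (V : Type) (v : V -> A) (t : term V) : A :=
  match t with
  | Var x => v x
  | Zero => op0
  | One => op1
  | Add s t => op_add (eval v s) (eval v t)
  | Mul s t => op_mul (eval v s) (eval v t)
  | Opp t => op_opp (eval v t)
  | Inv t => op_inv (eval v t)
  end.

Fixpoint numeral (V : Type) (n : nat) : term V :=
  if n is m.+1 then (numeral V m + 1)%Sg else 0%Sg.

Record equation := Equation { lhs : term nat; rhs : term nat }.
Notation "s =~ t" := (Equation s%Sg t%Sg) (at level 70).

Definition theory := equation -> Prop.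

Definition satisfies (A : sigma_algebra) (E : theory) : Prop :=
  forall e, E e -> forall v : nat -> A, eval v (lhs e) = eval v (rhs e).

(* Derivability in Birkhoff's equational logic. *)
Inductive provable (E : theory) : term nat -> term nat -> Prop :=
| prov_ax e (sg : nat -> term nat) :
    E e -> provable E (subst sg (lhs e)) (subst sg (rhs e))
| prov_refl t : provable E t t
| prov_sym s t : provable E s t -> provable E t s
| prov_trans s t u : provable E s t -> provable E t u -> provable E s u
| prov_add s s' t t' :
    provable E s s' -> provable E t t' -> provable E (s + t)%Sg (s' + t')%Sg
| prov_mul s s' t t' :
    provable E s s' -> provable E t t' -> provable E (s * t)%Sg (s' * t')%Sg
| prov_opp t t' : provable E t t' -> provable E (- t)%Sg (- t')%Sg
| prov_inv t t' : provable E t t' -> provable E (t^-1)%Sg (t'^-1)%Sg.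

Section Meadows.
Let x : term nat := Var 0.
Let y : term nat := Var 1.
Let z : term nat := Var 2.

Inductive Md : theory :=
| Md_addA : Md (x + y + z =~ x + (y + z))
| Md_addC : Md (x + y =~ y + x)
| Md_add0 : Md (x + 0 =~ x)
| Md_addN : Md (x + - x =~ 0)
| Md_mulA : Md (x * y * z =~ x * (y * z))
| Md_mulC : Md (x * y =~ y * x)
| Md_mul1 : Md (1 * x =~ x)
| Md_mulD : Md (x * (y + z) =~ x * y + x * z)
| Md_invK : Md (x^-1^-1 =~ x)
| Md_ril : Md (x * (x * x^-1) =~ x).
End Meadows.

Definition Md_char (k : nat) : theory :=
  fun e => Md e \/ e = (numeral nat k =~ 0).

Definition is_initial (E : theory) (A : sigma_algebra) : Prop :=
  satisfies A E /\
  forall B : sigma_algebra, satisfies B E ->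
    exists! f : A -> B, sigma_hom f.

(* Closed terms have no variables; they are embedded into open terms so that
   derivations between them may go through open terms. *)
Definition closed_term := term void.

HB.instance Definition _ := gen_eqMixin closed_term.
HB.instance Definition _ := gen_choiceMixin closed_term.

Definition open_term : closed_term -> term nat := subst (of_void (term nat)).

Section InitialAlgebra.
Variable E : theory.

Definition closed_eq : rel closed_term :=
  fun s t => `[< provable E (open_term s) (open_term t) >].

Lemma closed_eq_refl : reflexive closed_eq.
Proof. by move=> t; apply/asboolP; exact: prov_refl. Qed.

Lemma closed_eq_sym : symmetric closed_eq.
Proof. by move=> s t; apply/asboolP/asboolP; exact: prov_sym. Qed.

Lemma closed_eq_trans : transitive closed_eq.
Proof.
by move=> t s u /asboolP st /asboolP tu; apply/asboolP; exact: prov_trans tu.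
Qed.

Canonical closed_eq_equiv :=
  EquivRel closed_eq closed_eq_refl closed_eq_sym closed_eq_trans.

Local Open Scope quotient_scope.
Let Q := {eq_quot closed_eq}.

(* The operations are computed on representatives; the `pi_` lemmas below show
   that this is the usual quotient structure. *)
Definition initial_algebra : sigma_algebra := {|
  carrier := Q;
  op0 := \pi_Q 0%Sg;
  op1 := \pi_Q 1%Sg;
  op_add := fun a b => \pi_Q (repr a + repr b)%Sg;
  op_mul := fun a b => \pi_Q (repr a * repr b)%Sg;
  op_opp := fun a => \pi_Q (- repr a)%Sg;
  op_inv := fun a => \pi_Q ((repr a)^-1)%Sg
|}.

Lemma pi_eqP (s t : closed_term) :
  \pi_Q s = \pi_Q t <-> provable E (open_term s) (open_term t).
Proof. by split=> [/eqmodP/asboolP|st]; last by apply/eqmodP/asboolP. Qed.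

Lemma repr_piP (t : closed_term) :
  provable E (open_term (repr (\pi_Q t))) (open_term t).
Proof. by apply/pi_eqP; rewrite reprK. Qed.

Lemma pi_add s t :
  @op_add initial_algebra (\pi_Q s) (\pi_Q t) = \pi_Q (s + t)%Sg.
Proof. by apply/pi_eqP; apply: prov_add; exact: repr_piP. Qed.

Lemma pi_mul s t :
  @op_mul initial_algebra (\pi_Q s) (\pi_Q t) = \pi_Q (s * t)%Sg.
Proof. by apply/pi_eqP; apply: prov_mul; exact: repr_piP. Qed.

Lemma pi_opp t : @op_opp initial_algebra (\pi_Q t) = \pi_Q (- t)%Sg.
Proof. by apply/pi_eqP; apply: prov_opp; exact: repr_piP. Qed.

Lemma pi_inv t : @op_inv initial_algebra (\pi_Q t) = \pi_Q (t^-1)%Sg.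
Proof. by apply/pi_eqP; apply: prov_inv; exact: repr_piP. Qed.

Lemma eval_subst (A : sigma_algebra) V W (sg : V -> term W) (v : W -> A) t :
  eval v (subst sg t) = eval (fun x => eval v (sg x)) t.
Proof. by elim: t => //= [s -> t ->|s -> t ->|t ->|t ->]. Qed.

Lemma subst_subst U V W (sg : U -> term V) (tau : V -> term W) t :
  subst tau (subst sg t) = subst (fun x => subst tau (sg x)) t.
Proof. by elim: t => //= [s -> t ->|s -> t ->|t ->|t ->]. Qed.

Lemma provable_sound (A : sigma_algebra) s t :
  satisfies A E -> provable E s t -> forall v : nat -> A, eval v s = eval v t.
Proof.
move=> AE; elim=> {s t} //=.
- by move=> e sg Ee v; rewrite !eval_subst; exact: AE.
- by move=> s t u _ IH1 _ IH2 v; rewrite IH1.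
- by move=> s s' t t' _ IH1 _ IH2 v; rewrite IH1 IH2.
- by move=> s s' t t' _ IH1 _ IH2 v; rewrite IH1 IH2.
- by move=> t t' _ IH v; rewrite IH.
- by move=> t t' _ IH v; rewrite IH.
Qed.

Lemma eval_initial V (v : V -> initial_algebra) t :
  eval v t = \pi_Q (subst (fun x => repr (v x : Q)) t).
Proof.
elim: t => //= [x|s -> t ->|s -> t ->|t ->|t ->].
- by rewrite reprK.
- exact: pi_add.
- exact: pi_mul.
- exact: pi_opp.
- exact: pi_inv.
Qed.

Lemma eval_open (A : sigma_algebra) (v : nat -> A) (t : closed_term) :
  eval v (open_term t) = eval (of_void A) t.
Proof. by elim: t => //= [s -> t ->|s -> t ->|t ->|t ->]. Qed.

Theorem initial_algebraP : is_initial E initial_algebra.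
Proof.
split=> [e Ee v|B BE].
  rewrite !eval_initial; apply/pi_eqP.
  by rewrite /open_term !subst_subst; exact: prov_ax.
have evpi t : eval (of_void B) (repr (\pi_Q t)) = eval (of_void B) t.
  rewrite -!(eval_open (fun=> op0)).
  by apply: provable_sound => //; exact: repr_piP.
exists (fun a : Q => eval (of_void B) (repr a)); split.
  by split=> [||a b|a b|a|a]; rewrite evpi.
move=> g [g0 g1 gD gM gN gV]; apply: funext => a /=.
rewrite -[in RHS](reprK (a : Q)); elim: (repr (a : Q)) => //=.
- by move=> s -> t ->; rewrite -gD pi_add.
- by move=> s -> t ->; rewrite -gM pi_mul.
- by move=> t ->; rewrite -gN pi_opp.
- by move=> t ->; rewrite -gV pi_inv.
Qed.

End InitialAlgebra.

Definition Md_ (k : nat) : sigma_algebra := initial_algebra (Md_char k).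

(* In a `fieldType` the library's inverse is total with 0^-1 = 0 (`invr0`). *)
Definition zero_totalized (F : fieldType) : sigma_algebra := {|
  carrier := F;
  op0 := 0%R;
  op1 := 1%R;
  op_add := fun a b : F => (a + b)%R;
  op_mul := fun a b : F => (a * b)%R;
  op_opp := fun a : F => (- a)%R;
  op_inv := fun a : F => (a^-1)%R
|}.

(* Main.v *)
Require Import Defs.
From mathcomp Require Import all_boot all_algebra.
From HB Require Import structures.
From mathcomp Require Import boolp.

(** The zero totalized prime field is itself an initial model of [Md_char k]:
    a homomorphism from it is forced to send the class of [n] to the value of
    the [n]-th numeral, and this prescription does define a homomorphism into
    every model, because in a meadow [x * y = 1] implies [x^-1 = y].
    Initial models of a theory are isomorphic. *)

Set Implicit Arguments.
Unset Strict Implicit.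
Unset Printing Implicit Defensive.

Import GRing.Theory.
Local Open Scope ring_scope.

Lemma sigma_hom_id (A : sigma_algebra) : sigma_hom (@id A).
Proof. by []. Qed.

Lemma sigma_hom_comp (A B C : sigma_algebra) (g : B -> C) (f : A -> B) :
  sigma_hom g -> sigma_hom f -> sigma_hom (g \o f).
Proof.
move=> [g0 g1 gD gM gN gV] [f0 f1 fD fM fN fV].
split=> [||x y|x y|x|x] /=.
- by rewrite f0 g0.
- by rewrite f1 g1.
- by rewrite fD gD.
- by rewrite fM gM.
- by rewrite fN gN.
- by rewrite fV gV.
Qed.

Lemma initial_endo_id (E : theory) (A : sigma_algebra) (f : A -> A) :
  is_initial E A -> sigma_hom f -> f = id.
Proof.
move=> [AE /(_ A AE)[h [_ h_uniq]]] f_hom.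
by rewrite -(h_uniq f f_hom) (h_uniq id (sigma_hom_id A)).
Qed.

(** Both composites of the two mediating homomorphisms are endomorphisms of initial models, hence
    identities. *)
Lemma initial_isomorphic (E : theory) (A B : sigma_algebra) :
  is_initial E A -> is_initial E B -> sigma_isomorphic A B.
Proof.
move=> iA iB.
have [f [f_hom _]] := iA.2 B iB.1; have [g [g_hom _]] := iB.2 A iA.1.
exists f; split=> //; exists g => x.
  exact: (congr1 (@^~ x) (initial_endo_id iA (sigma_hom_comp g_hom f_hom))).
exact: (congr1 (@^~ x) (initial_endo_id iB (sigma_hom_comp f_hom g_hom))).
Qed.

(** The proof of the axioms is a parameter of this alias, so that the ring structure built from it
    can be attached to the type. *)
Definition meadow_ring (A : sigma_algebra) of satisfies A Md : Type := A.

Section MeadowRing.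
Variables (A : sigma_algebra) (MA : satisfies A Md).
Local Notation R := (meadow_ring MA).
Let val3 (x y z : A) : nat -> A := nth x [:: x; y; z].

Lemma meadow_addA : associative (@op_add A).
Proof. by move=> x y z; exact: esym (MA Md_addA (val3 x y z)). Qed.

Lemma meadow_addC : commutative (@op_add A).
Proof. by move=> x y; exact: (MA Md_addC (val3 x y x)). Qed.

Lemma meadow_add0 : left_id op0 (@op_add A).
Proof. by move=> x; rewrite meadow_addC; exact: (MA Md_add0 (val3 x x x)). Qed.

Lemma meadow_addN : left_inverse op0 (@op_opp A) (@op_add A).
Proof. by move=> x; rewrite meadow_addC; exact: (MA Md_addN (val3 x x x)). Qed.

Lemma meadow_mulA : associative (@op_mul A).
Proof. by move=> x y z; exact: esym (MA Md_mulA (val3 x y z)). Qed.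

Lemma meadow_mulC : commutative (@op_mul A).
Proof. by move=> x y; exact: (MA Md_mulC (val3 x y x)). Qed.

Lemma meadow_mul1 : left_id op1 (@op_mul A).
Proof. by move=> x; exact: (MA Md_mul1 (val3 x x x)). Qed.

Lemma meadow_mulD : left_distributive (@op_mul A) (@op_add A).
Proof.
move=> x y z; rewrite !(meadow_mulC _ z).
exact: (MA Md_mulD (val3 z x y)).
Qed.

HB.instance Definition _ := gen_eqMixin R.
HB.instance Definition _ := gen_choiceMixin R.
HB.instance Definition _ :=
  GRing.isZmodule.Build R meadow_addA meadow_addC meadow_add0 meadow_addN.
(** The structure must admit the zero ring, since a meadow may be trivial. *)
HB.instance Definition _ := GRing.Zmodule_isComPzRing.Build R
  meadow_mulA meadow_mulC meadow_mul1 meadow_mulD.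

Lemma meadow_numeral V (v : V -> A) n : eval v (numeral V n) = n%:R :> R.
Proof. by elim: n => //= n ->; rewrite -natr1. Qed.

Let inv : R -> R := @op_inv A.

Lemma meadow_invK : involutive inv.
Proof. by move=> x; exact: (MA Md_invK (val3 x x x)). Qed.

Lemma meadow_ril x : x * (x * inv x) = x.
Proof. exact: (MA Md_ril (val3 x x x)). Qed.

(** Instantiating [meadow_ril] at [inv 0] turns its innermost factor into [inv (inv 0) = 0]. *)
Lemma meadow_inv0 : inv 0 = 0.
Proof. by have := meadow_ril (inv 0); rewrite meadow_invK !mulr0. Qed.

(** Multiplying [x * (x * inv x) = x] by [y] gives [x * inv x = 1], and inverses in a commutative
    ring are unique. *)
Lemma meadow_inv_unique x y : x * y = 1 -> inv x = y.
Proof.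
move=> xy1; have xV1 : x * inv x = 1.
  by rewrite -xy1 -[in RHS](meadow_ril x) mulrAC xy1 mul1r.
by rewrite -[LHS]mulr1 -xy1 mulrA [_ * x]mulrC xV1 mul1r.
Qed.

End MeadowRing.

Lemma zero_totalized_numeral (F : fieldType) V (v : V -> zero_totalized F) n :
  eval v (numeral V n) = n%:R :> F.
Proof. by elim: n => //= n ->; rewrite natr1. Qed.

Lemma zero_totalized_Md (F : fieldType) : satisfies (zero_totalized F) Md.
Proof.
move=> _ [] v /=.
- by rewrite addrA.
- exact: addrC.
- exact: addr0.
- exact: subrr.
- by rewrite mulrA.
- exact: mulrC.
- exact: mul1r.
- exact: mulrDr.
- exact: invrK.
- have [->|x0] := eqVneq (v 0%N : F) 0; first exact: mul0r.
  by rewrite divff // mulr1.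
Qed.

Lemma hom_natr (F : fieldType) (A : sigma_algebra) (MA : satisfies A Md)
    (f : zero_totalized F -> A) n :
  sigma_hom f -> f (n%:R : F) = n%:R :> meadow_ring MA.
Proof.
by move=> [f0 f1 fD _ _ _]; elim: n => // n IHn; rewrite -!natr1 fD IHn f1.
Qed.

Lemma prime_field_initial (k : nat) :
  prime k -> is_initial (Md_char k) (zero_totalized 'F_k).
Proof.
move=> k_prime; split=> [e [Me|->] v|A AE].
- exact: zero_totalized_Md.
- by rewrite zero_totalized_numeral; apply: pchar_Fp_0.
have MA : satisfies A Md by move=> e Me; apply: AE; left.
pose R : comPzRingType := meadow_ring MA.
have kR0 : k%:R = 0 :> R.
  have <- := meadow_numeral MA (fun _ : nat => op0 : A) k.
  exact: (AE _ (or_intror erefl)).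
(* The candidate homomorphism goes through the representative of [a] below [k]. *)
pose g (a : 'F_k) : R := (a : nat)%:R.
(* Reducing [n] modulo [k] does not change its image, as [k%:R = 0] in [R]. Every element of ['F_k]
   is some [n%:R], so compatibility with sums and products follows. *)
have gn n : g n%:R = n%:R.
  rewrite /g val_Fp_nat // [in RHS](divn_eq n k) natrD natrM kR0 mulr0.
  by rewrite add0r.
have gD a b : g (a + b) = g a + g b.
  by rewrite -(natr_Zp a) -(natr_Zp b) -natrD !gn natrD.
have gM a b : g (a * b) = g a * g b.
  by rewrite -(natr_Zp a) -(natr_Zp b) -natrM !gn natrM.
have g0 : g 0 = 0 := gn 0%N.
have g1 : g 1 = 1 := gn 1%N.
exists g; split.
  split=> // [a|a] /=.
    by apply: (@addIr R (g a)); rewrite -gD addNr g0 (addNr (g a)).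
  (* At zero both totalized inverses are [0]; elsewhere [g] maps [a * a^-1 = 1] to an equation that
     determines [inv (g a)]. *)
  have [->|a0] := eqVneq (a : 'F_k) 0.
    by rewrite invr0 g0 (meadow_inv0 MA).
  by apply/esym/(meadow_inv_unique (MA := MA)); rewrite -gM divff.
move=> f f_hom; apply: funext => a.
by rewrite -(natr_Zp (a : 'F_k)) gn (hom_natr MA).
Qed.

Theorem mainTheorem4 (k : nat) (hk : prime k) :
  sigma_isomorphic (Md_ k) (zero_totalized 'F_k).
Proof.
exact: initial_isomorphic (initial_algebraP _) (prime_field_initial hk).
Qed.
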